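(* Let $n\geq 2$ and $d=\frac{n}{2}-1$. A real $n\times n$ circulant matrix $C$ with generator $(c_0,c_1,\ldots,c_{n-1})$ satisfies $c_0=d$, $c_j\in\{1,-1\}$ for all $j=1,\ldots,n-1$, and $CC^T=(d^2+n-1)I$ if and only if its generator is one of the following: \begin{itemize} \item $g_1=\left(\frac{n}{2}-1,-1,-1,\ldots,-1\right)$ (for any $n\geq2$); \item $g_2=\left(\frac{n}{2}-1,1,-1,1,-1,\ldots,-1,1\right)$, i.e. $c_j=(-1)^{j+1}$ for $1\le j\le n-1$ (only for even $n$); \item $g_{4a}=\left(\frac{n}{2}-1,1,1,-1,-1,1,1,-1,\ldots,-1,1,1,-1\right)$, i.e. for $1\le j\le n-1$, $c_j=1$ if $j\equiv 1,2\pmod 4$ and $c_j=-1$ if $j\equiv 0,3\pmod 4$ (only for $n$ a multiple of $4$); \item $g_{4b}=\left(\frac{n}{2}-1,-1,1,1,-1,-1,1,1,\ldots,-1,-1,1,1\right)$, i.e. for $1\le j\le n-1$, $c_j=-1$ if $j\equiv 0,1\pmod 4$ and $c_j=1$ if $j\equiv 2,3\pmod 4$ (only for $n$ a multiple of $4$). \end{itemize} In particular, such a matrix $C$ (with $n=2(d+1)$) exists for every $n\geq 2$.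
   Context: A circulant matrix of order $n$ with generator $(c_0,c_1,\ldots,c_{n-1})$ is the $n\times n$ matrix whose entry in row $i$ and column $j$ (rows and columns indexed $0,\ldots,n-1$) is $c_{(j-i)\bmod n}$; i.e. each row is the previous row cyclically shifted one position to the right, and the first row is the generator. *)

(* Defs.v *)
From HB Require Import structures.
From mathcomp Require Import all_boot all_order all_algebra.
From mathcomp Require Import reals.

Set Implicit Arguments.
Unset Strict Implicit.
Unset Printing Implicit Defensive.

Import Order.TTheory GRing.Theory Num.Theory.
Local Open Scope ring_scope.

Lemma ord_bound_gt0 (n : nat) (i : 'I_n) : (0 < n)%N.
Proof. exact: leq_ltn_trans (leq0n i) (ltn_ord i). Qed.

(* The index (j - i) mod n.  As i < n, the truncated difference n - i is
   exact, so that j + (n - i) is congruent to j - i modulo n. *)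
Definition ord_diff (n : nat) (j i : 'I_n) : 'I_n :=
  Ordinal (ltn_pmod (j + (n - i))%N (ord_bound_gt0 i)).

Definition circulant (R : Type) (n : nat) (c : 'rV[R]_n) : 'M[R]_n :=
  \matrix_(i < n, j < n) c ord0 (ord_diff j i).

Definition orthogonal_circulant_generator (R : realType) (n : nat) (d : R)
    (c : 'rV[R]_n) : Prop :=
  [/\ forall j : 'I_n, j = 0%N :> nat -> c ord0 j = d,
      forall j : 'I_n, (0 < j)%N -> c ord0 j = 1 \/ c ord0 j = -1
    & circulant c *m (circulant c)^T = (d ^+ 2 + n%:R - 1)%:M].

Definition generator (R : realType) (n : nat) (d : R) (f : nat -> R) :
    'rV[R]_n :=
  \row_(j < n) (if j == 0%N :> nat then d else f j).

Definition g1 (R : realType) (n : nat) : 'rV[R]_n :=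
  generator n (n%:R / 2%:R - 1) (fun _ => -1).

Definition g2 (R : realType) (n : nat) : 'rV[R]_n :=
  generator n (n%:R / 2%:R - 1) (fun j => (-1) ^+ j.+1).

Definition g4a (R : realType) (n : nat) : 'rV[R]_n :=
  generator n (n%:R / 2%:R - 1)
    (fun j => if (j %% 4)%N \in [:: 1; 2]%N then 1 else -1).

Definition g4b (R : realType) (n : nat) : 'rV[R]_n :=
  generator n (n%:R / 2%:R - 1)
    (fun j => if (j %% 4)%N \in [:: 2; 3]%N then 1 else -1).

(* Main.v *)
(* Put w_j = -c_j for j <> 0 and w_0 = 1, extended n-periodically.  The matrix
   equation says that the autocorrelation A(s) = sum_j w_j w_(j+s) equals
   n (w_s + w_(-s)) / 2.  Hence either w_(-s) = w_s, A(s) = n w_s and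
   w_(j+s) = w_s w_j for all j, or w_(-s) = - w_s and A(s) = 0.  Let m > 0 be
   the least shift of the first kind.  If m = 1 then w_j = w_1^j.  If m > 1, the
   sum of w_j w_(j+s) over a window of length m vanishes for 0 < s < m; so m is
   even, and w_m = 1 is impossible since s = m/2 would be of the first kind.  If
   w_m = -1, the product of w_j w_(j+s) over the window is (-1)^s, while a
   vanishing sum of m signs has product (-1)^(m/2); s = 1 and s = 2 cannot both
   occur, so m = 2. *)

Require Import Defs.
From HB Require Import structures.
From mathcomp Require Import all_boot all_order all_algebra.
From mathcomp Require Import reals.
From mathcomp Require Import zify ring.

Set Implicit Arguments.
Unset Strict Implicit.
Unset Printing Implicit Defensive.

Import Order.TTheory GRing.Theory Num.Theory.
Local Open Scope ring_scope.

(** * Sums of periodic sequences over windows *)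

Lemma sum_periodic_shift (V : zmodType) (p t : nat) (f : nat -> V) :
  (forall j, f (j + p)%N = f j) ->
  \sum_(j < p) f (j + t)%N = \sum_(j < p) f j.
Proof.
move=> fp; elim: t => [|t <-]; first by apply: eq_bigr => j _; rewrite addn0.
(* The [p + 1] terms from [f t] on are split at the first term and at the last; these two agree by
   periodicity. *)
apply: (addrI (f t)).
have := @big_ord_recl V 0 +%R p (fun j : 'I_p.+1 => f (j + t)%N) => /=.
rewrite big_ord_recr /= add0n [(p + t)%N]addnC fp addrC => ->.
by congr (_ + _); apply: eq_bigr => j _; rewrite addnS.
Qed.

Lemma sum_periodic_mul (V : zmodType) (p q : nat) (f : nat -> V) :
  (forall j, f (j + p)%N = f j) ->
  \sum_(j < q * p) f j = (\sum_(j < p) f j) *+ q.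
Proof.
move=> fp; elim: q => [|q IH]; first by rewrite big_ord0.
rewrite mulSn big_split_ord /= mulrS -IH; congr (_ + _).
by apply: eq_bigr => j _; rewrite addnC fp.
Qed.

Lemma periodic_mul (T : Type) (p q : nat) (f : nat -> T) j :
  (forall j, f (j + p)%N = f j) -> f (j + q * p)%N = f j.
Proof. by move=> fp; elim: q => [|q IH]; rewrite ?addn0 // mulSnr addnA fp. Qed.

Lemma periodic_modn (T : Type) (p : nat) (f : nat -> T) j :
  (forall j, f (j + p)%N = f j) -> f (j %% p)%N = f j.
Proof. by move=> fp; rewrite {2}(divn_eq j p) addnC periodic_mul. Qed.

(** * Finite sums and products of signs *)

Section SignSequences.
Variable R : numDomainType.
Implicit Types x w : nat -> R.

Definition sign_valued w := forall j, w j = 1 \/ w j = -1.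

Lemma sign_mul a b : (a = 1 \/ a = -1) -> (b = 1 \/ b = -1) ->
  a * b = 1 \/ a * b = -1 :> R.
Proof. by move=> [->|->] [->|->]; rewrite ?mulr1 ?mul1r ?mulN1r ?opprK; auto. Qed.

Lemma sign_sqr w j : sign_valued w -> w j * w j = 1.
Proof. by case/(_ j) => ->; rewrite ?mulr1 ?mulN1r ?opprK. Qed.

Lemma sign_eq_opp w j k : sign_valued w -> w j <> w k -> w j = - w k.
Proof. by move=> s; case: (s j) (s k) => -> [] ->; rewrite ?opprK. Qed.

Lemma sign_neq : 1 <> -1 :> R.
Proof. by move/eqP; rewrite -subr_eq0 opprK -mulr2n pnatr_eq0. Qed.

(** Here [k] counts the entries equal to -1. *)
Lemma sign_sum_prod m x : sign_valued x ->
  exists k, \sum_(j < m) x j + (2 * k)%:R = m%:R /\ \prod_(j < m) x j = (-1) ^+ k.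
Proof.
move=> sx; elim: m => [|m [k [IHs IHp]]].
  by exists 0%N; rewrite !big_ord0 addr0 expr0.
rewrite !big_ord_recr /= IHp.
case: (sx m) => ->; [exists k|exists k.+1]; split.
- rewrite -natr1 -IHs; ring.
- by rewrite mulr1.
- rewrite -natr1 -IHs mulnS natrD; ring.
- by rewrite -exprSr.
Qed.

Lemma sign_sum0 m x : sign_valued x -> \sum_(j < m) x j = 0 ->
  exists k, m = (2 * k)%N /\ \prod_(j < m) x j = (-1) ^+ k.
Proof.
move=> sx e; case: (sign_sum_prod m sx) => k []; rewrite e add0r => /eqP.
by rewrite eqr_nat => /eqP <- ?; exists k.
Qed.

Lemma sign_sum_max m x : sign_valued x -> \sum_(j < m) x j = m%:R ->
  forall j : 'I_m, x j = 1.
Proof.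
move=> sx e j; have /eqP : \sum_(i < m) (1 - x i) = 0.
  by rewrite sumrB e sumr_const card_ord subrr.
rewrite psumr_eq0 => [/allP /(_ j)|i _].
  by rewrite mem_index_enum subr_eq0 => /(_ isT) /eqP.
by case: (sx i) => ->; rewrite ?subrr ?opprK ?addr_ge0.
Qed.

Lemma antiperiodic_pow w m j k : (forall i, w (i + m)%N = - w i) ->
  w (j + k * m)%N = (-1) ^+ k * w j.
Proof.
move=> wm; elim: k => [|k IH]; first by rewrite addn0 mul1r.
by rewrite mulSnr addnA wm IH exprS -mulrA mulN1r.
Qed.

(* Shifting a window of length [m] by one trades a factor for its opposite. *)
Lemma antiperiodic_prod w m s : (0 < m)%N -> (forall j, w (j + m)%N = - w j) ->
  \prod_(j < m) w (j + s)%N = (-1) ^+ s * \prod_(j < m) w j.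
Proof.
case: m => // m _ wm; elim: s => [|s IH].
  by rewrite mul1r; apply: eq_bigr => j _; rewrite addn0.
rewrite exprS -mulrA -IH big_ord_recr big_ord_recl /=.
have -> : (m + s.+1 = s + m.+1)%N by lia.
rewrite wm add0n mulrN mulN1r mulrC; congr (- (_ * _)).
by apply: eq_bigr => j _; rewrite /bump addnS.
Qed.

(** The product of [w j * w (j + s)] over the window is computed twice: as [(-1) ^+ s] by
    antiperiodicity, and as [(-1) ^+ k] because half of these signs are -1. *)
Lemma antiperiodic_sum0 w m s : sign_valued w -> (0 < m)%N ->
  (forall j, w (j + m)%N = - w j) -> \sum_(j < m) w j * w (j + s)%N = 0 ->
  exists2 k, m = (2 * k)%N & odd k = odd s.
Proof.
move=> sw m0 wm e.
have sx : sign_valued (fun j => w j * w (j + s)%N) by move=> j; apply: sign_mul.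
case: (sign_sum0 sx e) => k [mk]; rewrite big_split /= antiperiodic_prod //.
rewrite mulrCA -big_split /= big1 => [|j _]; last exact: sign_sqr.
rewrite mulr1 -signr_odd -[RHS]signr_odd => eks; exists k => //.
by case: (odd k) (odd s) eks => [] [] //= e1; case: sign_neq; do [exact: e1 | exact: esym e1].
Qed.

(** * Classification of the balanced sign sequences *)

Section Balanced.
Variables (n : nat) (w : nat -> R).
Hypotheses (n_gt0 : (0 < n)%N) (w_sign : sign_valued w) (w0 : w 0%N = 1).
Hypothesis w_periodic : forall j, w (j + n)%N = w j.

(** Doubling avoids a division in [R], and [s <= n] makes [n - s] represent [-s] modulo [n]. *)
Definition balanced :=
  forall s, (s <= n)%N ->
    2%:R * \sum_(j < n) w j * w (j + s)%N = n%:R * (w s + w (n - s)%N).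

Hypothesis w_balanced : balanced.

(** The [n] signs [w s * (w j * w (j + s))] sum to [n], so each of them is 1. *)
Lemma balanced_mul s j : (s <= n)%N -> w (n - s)%N = w s ->
  w (j + s)%N = w s * w j.
Proof.
move=> sn es; have := w_balanced sn; rewrite es -mulr2n -[w s *+ 2]mulr_natl mulrCA.
move/(mulfI (_ : 2%:R != 0 :> R)); rewrite pnatr_eq0 => /(_ isT) e.
have sx : sign_valued (fun j => w s * (w j * w (j + s)%N)).
  by move=> i; do !apply: sign_mul.
have /(sign_sum_max sx) : \sum_(j < n) w s * (w j * w (j + s)%N) = n%:R.
  by rewrite -mulr_sumr e mulrCA sign_sqr ?mulr1.
move=> /(_ (Ordinal (ltn_pmod j n_gt0))) /=.
rewrite (periodic_modn j w_periodic).
rewrite (periodic_modn (f := fun j => w (j + s)%N)); last first.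
  by move=> i; rewrite addnAC w_periodic.
move=> e1; rewrite -[RHS]mulr1 -{}e1; rewrite -!mulrA.
rewrite (mulrCA (w j)) [w j * (w j * _)]mulrA sign_sqr // mul1r.
by rewrite mulrA sign_sqr ?mul1r.
Qed.

Lemma balanced_sum0 s : (s <= n)%N -> w (n - s)%N <> w s ->
  \sum_(j < n) w j * w (j + s)%N = 0.
Proof.
move=> sn ne; have := w_balanced sn.
rewrite (sign_eq_opp w_sign ne) subrr mulr0 => /eqP.
by rewrite mulf_eq0 pnatr_eq0 => /eqP.
Qed.

(** The summand has both periods [n] and [m], so its sum over [n * m] terms is [n] times the window
    sum and [m] times the full sum, which is 0. *)
Lemma window_sum0 m s e : (s <= n)%N -> w (n - s)%N <> w s ->
  e * e = 1 -> (forall j, w (j + m)%N = e * w j) ->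
  \sum_(j < m) w j * w (j + s)%N = 0.
Proof.
move=> sn ne ee wm; set f := fun j => w j * w (j + s)%N.
have fn j : f (j + n)%N = f j by rewrite /f addnAC !w_periodic.
have fm j : f (j + m)%N = f j by rewrite /f addnAC !wm mulrACA ee mul1r.
have := sum_periodic_mul n fm; rewrite mulnC (sum_periodic_mul m fn).
rewrite balanced_sum0 // mul0rn => /esym /eqP.
by rewrite mulrn_eq0 eqn0Ngt n_gt0 => /eqP.
Qed.

Lemma balanced_classification :
  [\/ w =1 (fun _ => 1),
      ~~ odd n /\ w =1 (fun j => (-1) ^+ j),
      (4 %| n)%N /\ w =1 (fun j => (-1) ^+ (uphalf j))
    | (4 %| n)%N /\ w =1 (fun j => (-1) ^+ (j./2))].
Proof.
have wn : w n = 1 by rewrite -[n]add0n w_periodic.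
have exm : exists m, [&& (0 < m)%N, (m <= n)%N & w (n - m)%N == w m].
  by exists n; rewrite n_gt0 leqnn subnn w0 wn eqxx.
case: (ex_minnP exm) => m /and3P [m0 mn /eqP em] m_min.
have wm j : w (j + m)%N = w m * w j by exact: balanced_mul.
have ws s : (0 < s < m)%N -> w (n - s)%N <> w s.
  move=> /andP [s0 sm] /eqP es; have := m_min s; rewrite s0 es.
  by rewrite (leq_trans (ltnW sm)) // leqNgt sm => /(_ isT).
have F s : (0 < s < m)%N -> \sum_(j < m) w j * w (j + s)%N = 0.
  move=> sm; apply: (window_sum0 _ (ws _ sm) _ wm); last exact: sign_sqr.
  by case/andP: sm => _ /ltnW /leq_trans ->.
have [m1|m_gt1] : m = 1%N \/ (1 < m)%N by lia.
  have wX j : w j = w 1%N ^+ j.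
    elim: j => [|j IH]; first by rewrite w0.
    by rewrite -addn1 -m1 wm IH m1 addn1 exprS.
  case: (w_sign 1) => w1; first by apply: Or41 => j; rewrite wX w1 expr1n.
  apply: Or42; split=> [|j]; last by rewrite wX w1.
  move: wn; rewrite wX w1 -signr_odd; case: (odd n) => //; rewrite expr1.
  by move=> /esym /sign_neq.
have F1 := F 1%N m_gt1.
have sx s : sign_valued (fun j => w j * w (j + s)%N) by move=> j; apply: sign_mul.
case: (w_sign m) => wm1.
  case: (sign_sum0 (sx 1%N) F1) => k [mk _].
  (* As [w] has period [m = 2 k], [w (n - k) = w (n + k) = w k], so the smaller shift [k]
     contradicts minimality. *)
  have km : (0 < k < m)%N by lia.
  case: (ws _ km); rewrite -[LHS]mul1r -wm1 -wm.
  by have -> : (n - k + m = k + n)%N by lia.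
have wN j : w (j + m)%N = - w j by rewrite wm wm1 mulN1r.
have m2 : m = 2%N.
  case: (antiperiodic_sum0 w_sign m0 wN F1) => k mk ok.
  have [//|m_gt2] : m = 2%N \/ (2 < m)%N by lia.
  case: (antiperiodic_sum0 w_sign m0 wN (F 2%N m_gt2)) => l ml ol.
  have klE : k = l by lia.
  by move: ok; rewrite klE ol.
move: wN; rewrite m2 => wN.
(* The value [w (2 * q) = (-1) ^+ q] is 1 at [q = n], which excludes odd [n], and then at
   [q = n / 2], which must be even. *)
have n4 : (4 %| n)%N.
  have n_even : ~~ odd n.
    apply/negP => on; have := antiperiodic_pow 0 n wN.
    rewrite add0n mulnC mul2n -addnn w_periodic wn w0 mulr1 -signr_odd on expr1.
    exact: sign_neq.
  have := antiperiodic_pow 0 n./2 wN.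
  have nE : (n./2 * 2 = n)%N by lia.
  rewrite add0n nE wn w0 mulr1 -signr_odd; case o: (odd n./2).
    by rewrite expr1 => /sign_neq.
  by move=> _; lia.
have wE j : w j = (-1) ^+ j./2 * w (odd j).
  rewrite -(antiperiodic_pow _ _ wN); congr w; lia.
case: (w_sign 1) => w1; [apply: Or44|apply: Or43]; split=> // j; rewrite wE.
  by case: (odd j); rewrite ?w0 ?w1 mulr1.
rewrite uphalf_half; case: (odd j); rewrite ?w0 ?w1 ?mulr1 //.
by rewrite exprD expr1 mulrC.
Qed.
End Balanced.

(** * Sequences that are balanced *)

Lemma balanced1 n : balanced n (fun _ : nat => 1).
Proof.
by move=> s _; rewrite mulr1 sumr_const card_ord mulrC.
Qed.

Lemma balanced_alternating n : ~~ odd n -> balanced n (fun j => (-1) ^+ j : R).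
Proof.
move=> on s sn.
rewrite (eq_bigr (fun _ => (-1) ^+ s)) => [|j _]; last first.
  by rewrite exprD mulrA -expr2 sqrr_sign mul1r.
rewrite sumr_const card_ord -[(-1) ^+ (n - s)]signr_odd oddB // (negbTE on) /=.
by rewrite signr_odd -mulr_natl; ring.
Qed.

(** Serves both sequences for [4 %| n], with the sign [w 1] left free. The correlation is [n / 4]
    times a sum over one period of length 4, which equals [2 * (w s + w 1 * w (s + 1))]. *)
Lemma balanced_half_periodic n w : (4 %| n)%N -> sign_valued w ->
  (forall j, w (j + 2)%N = - w j) -> w 0%N = 1 -> balanced n w.
Proof.
move=> /dvdnP [q nE] sw wN w0 s sn.
have w4 j : w (j + 4)%N = w j by rewrite (addnA j 2 2) !wN opprK.
have f4 j : w (j + 4)%N * w (j + 4 + s)%N = w j * w (j + s)%N.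
  by rewrite addnAC !w4.
rewrite nE (sum_periodic_mul q f4) -nE.
have wE t : w t = (-1) ^+ t./2 * w (odd t).
  by rewrite -(antiperiodic_pow _ _ wN); congr w; lia.
(* Modulo 4, [-s] is [s] for even [s] and [s + 2] for odd [s]; this one formula fits both
   parities. *)
have -> : w (n - s)%N = w 1%N * w (s + 1)%N.
  have parity : odd (n - s) = odd s by rewrite oddB // nE oddM andbF.
  rewrite [LHS]wE [w (s + 1)%N]wE parity addn1 /= -(signr_odd _ (n - s)./2).
  rewrite -(signr_odd _ (uphalf s)).
  have -> : odd (n - s)./2 = odd (uphalf s) by lia.
  by case: (odd s); rewrite ?w0 ?mulr1 mulrC // -mulrA sign_sqr // mulr1.
rewrite !big_ord_recl big_ord0 /= /bump /= !add1n addr0 w0.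
rewrite (wN 0%N) (wN 1%N) !(addnC _ s) addn0 (addnA s 1 2)%N !wN w0 !addn1.
rewrite nE natrM -[_ *+ q]mulr_natl; ring.
Qed.
End SignSequences.

(** * From circulant matrices to autocorrelations *)

Section Circulant.
Variables (R : realType) (n : nat).
Hypothesis n_gt0 : (0 < n)%N.
Let h : R := n%:R / 2%:R.

(** Divisibility by [n] acts as an [n]-periodic Kronecker delta at 0. *)
Lemma sum_dvdn (G : nat -> R) : \sum_(j < n) (n %| j)%:R * G j = G 0%N.
Proof.
case: n n_gt0 => // p _; rewrite big_ord_recl dvdn0 mul1r big1 ?addr0 // => i _.
by rewrite lift0 gtnNdvd ?mul0r // ltnS.
Qed.

Section Sequence.
Variable w : nat -> R.
Hypotheses (w_sign : sign_valued w) (w0 : w 0%N = 1).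
Hypothesis w_periodic : forall j, w (j + n)%N = w j.

Let c := generator n (h - 1) (fun j => - w j).
(** Since [w 0 = 1], the first entry [h - 1] is [h - w 0], so the periodically extended generator is
    [h] times the delta minus [w]. *)
Let C j := h * (n %| j)%:R - w j.

Lemma generatorE (j : 'I_n) : c ord0 j = C j.
Proof.
rewrite mxE /C; case: eqP => [->|/eqP]; first by rewrite dvdn0 mulr1 w0.
by rewrite -lt0n => j0; rewrite gtnNdvd // mulr0 sub0r.
Qed.

Let C_periodic j : C (j + n)%N = C j.
Proof. by rewrite /C w_periodic dvdn_addl. Qed.

Lemma circulantE i j : circulant c i j = C (j + (n - i))%N.
Proof. by rewrite mxE generatorE /= periodic_modn. Qed.

Lemma circulant_correlation s : (s <= n)%N ->
  \sum_(j < n) C j * C (j + s)%N =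
  h ^+ 2 * (n %| s)%:R - h * (w s + w (n - s)%N) + \sum_(j < n) w j * w (j + s)%N.
Proof.
move=> sn.
(* Each isolated term is spread over [j] by means of the delta, so that the identity can be checked
   summand by summand. *)
have -> : w (n - s)%N = \sum_(j < n) w j * (n %| j + s)%:R.
  rewrite -(sum_periodic_shift (n - s) (f := fun j => w j * (n %| j + s)%:R)).
    rewrite -[LHS](sum_dvdn (fun j => w (j + (n - s))%N)).
    by apply: eq_bigr => j _; rewrite -addnA subnK // dvdn_addl // mulrC.
  by move=> j; rewrite w_periodic addnAC dvdn_addl.
rewrite -[w s](sum_dvdn (fun j => w (j + s)%N)).
rewrite -[(n %| s)%:R](sum_dvdn (fun j => (n %| j + s)%:R)).
rewrite -big_split /= !mulr_sumr -sumrB -big_split /=.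
by apply: eq_bigr => j _; rewrite /C; ring.
Qed.

Lemma circulant_mul_trE (i k : 'I_n) : let s := ((i + (n - k)) %% n)%N in
  (circulant c *m (circulant c)^T) i k =
  h ^+ 2 *+ (i == k) - h * (w s + w (n - s)%N) + \sum_(j < n) w j * w (j + s)%N.
Proof.
set s := ((i + (n - k)) %% n)%N => /=.
have sn : (s <= n)%N by rewrite ltnW // ltn_pmod.
have -> : h ^+ 2 *+ (i == k) = h ^+ 2 * (n %| s)%:R.
  rewrite mulr_natr /s /dvdn modn_mod; congr (_ *+ nat_of_bool _).
  apply/eqP/eqP => [->|].
    by rewrite subnKC ?modnn // ltnW.
  (* As [0 < i + (n - k) < 2 n], the only possible multiple of [n] is [n] itself. *)
  move=> /eqP /dvdnP [q qE]; apply: val_inj => /=.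
  have := ltn_ord i; have := ltn_ord k.
  by case: q qE => [|[|q]]; rewrite ?mulSn; lia.
rewrite -circulant_correlation // mxE.
under eq_bigr => j _ do rewrite [_^T _ _]mxE !circulantE.
rewrite -(sum_periodic_shift i (f := fun j => C (j + (n - i)) * C (j + (n - k)))).
  apply: eq_bigr => j _; rewrite -addnA subnKC ?C_periodic; last exact: ltnW.
  congr (_ * _); rewrite -(periodic_modn (j + i + (n - k)) C_periodic).
  by rewrite -(periodic_modn (j + s) C_periodic) modnDmr addnA.
by move=> j; rewrite 2!(addnAC j n) !C_periodic.
Qed.

Lemma orthogonal_balanced :
  orthogonal_circulant_generator (h - 1) c <-> balanced n w.
Proof.
(* The prescribed scalar is exactly the delta term [h ^+ 2] of the correlation, so orthogonality
   says that the remaining terms cancel. *)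
have hE : (h - 1) ^+ 2 + n%:R - 1 = h ^+ 2 by rewrite /h; field.
have nE : n%:R = 2%:R * h by rewrite /h; field.
split=> [[_ _ orth] s|bal].
  (* The shift [s = n] is not a matrix index and is checked directly; for [s < n] the entry in row
     [s] and column 0 is used. *)
  rewrite leq_eqVlt => /orP [/eqP ->|sn].
    have wn : w n = 1 by rewrite -[n]add0n w_periodic.
    rewrite subnn w0 wn (eq_bigr (fun=> 1)) => [|j _]; last first.
      by rewrite w_periodic sign_sqr.
    by rewrite sumr_const card_ord mulrC.
  have := circulant_mul_trE (Ordinal sn) (Ordinal n_gt0).
  rewrite orth mxE hE /= subn0 modnDr modn_small // => e.
  move: e; rewrite -[LHS]addr0 -[RHS]addrA => /addrI e.
  rewrite nE -mulrA; congr (_ * _); apply/eqP.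
  by rewrite -subr_eq0 addrC -e.
split=> [j j0|j j0|].
- by rewrite mxE j0.
- rewrite mxE eqn0Ngt j0; case: (w_sign j) => ->; rewrite ?opprK; tauto.
apply/matrixP => i k; rewrite circulant_mul_trE mxE hE.
set s := (_ %% _)%N; have := bal s (ltnW (ltn_pmod _ n_gt0)).
rewrite nE -mulrA => /(mulfI (_ : 2%:R != 0 :> R)); rewrite pnatr_eq0 => /(_ isT) ->.
by rewrite subrK.
Qed.
End Sequence.

Lemma orthogonal_generatorP (c : 'rV[R]_n) :
  orthogonal_circulant_generator (h - 1) c ->
  exists w, [/\ sign_valued w, w 0%N = 1, forall j, w (j + n)%N = w j
              & c = generator n (h - 1) (fun j => - w j)].
Proof.
move=> [c0 csign _].
(* The entries change sign, and the entry [d] is replaced by 1. *)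
pose w j := if (n %| j)%N then 1 else - c ord0 (Ordinal (ltn_pmod j n_gt0)).
exists w; split=> [j||j|]; rewrite /w ?dvdn0 //.
- case: ifP => [_|nj]; first by left.
  case: (csign (Ordinal (ltn_pmod j n_gt0))) => [|->|->]; rewrite ?opprK; try tauto.
  by rewrite lt0n /= -/(dvdn n j) nj.
- rewrite dvdn_addl //; case: ifP => // _; congr (- c _ _).
  by apply: val_inj; rewrite /= modnDr.
apply/rowP => j; rewrite mxE; case: eqP => [/c0 //|/eqP].
rewrite -lt0n => j0; rewrite gtnNdvd // opprK; congr (c _ _).
by apply: val_inj; rewrite /= modn_small.
Qed.
End Circulant.

(** * The four generators *)

Lemma eq_generator (R : realType) n (d : R) f g : (forall j, (0 < j)%N -> f j = g j) ->
  generator n d f = generator n d g.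
Proof.
move=> fg; apply/rowP => j; rewrite !mxE; case: eqP => // /eqP.
by rewrite -lt0n; exact: fg.
Qed.

Theorem theorem5p3 (R : realType) (n : nat) (hn : (2 <= n)%N) :
  let d : R := n%:R / 2%:R - 1 in
  (forall c : 'rV[R]_n,
     orthogonal_circulant_generator d c <->
     [\/ c = g1 R n,
         ~~ odd n /\ c = g2 R n,
         (4 %| n)%N /\ c = g4a R n
       | (4 %| n)%N /\ c = g4b R n])
  /\ (exists c : 'rV[R]_n, orthogonal_circulant_generator d c).
Proof.
move=> d; have n0 : (0 < n)%N by exact: ltnW.
(* Each listed generator is written with entries [- w j], where [w] is a sequence of
   [balanced_classification]. *)
have g1E : g1 R n = generator n d (fun=> -1) by [].
have g2E : g2 R n = generator n d (fun j => - (-1) ^+ j).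
  by apply: eq_generator => j _; rewrite exprS mulN1r.
have g4aE : g4a R n = generator n d (fun j => - (-1) ^+ (uphalf j)).
  apply: eq_generator => j _; rewrite -signr_odd !inE.
  case: ifP => jE; case: (boolP (odd (uphalf j))) => o; rewrite ?expr1 ?opprK //; lia.
have g4bE : g4b R n = generator n d (fun j => - (-1) ^+ j./2).
  apply: eq_generator => j _; rewrite -signr_odd !inE.
  case: ifP => jE; case: (boolP (odd j./2)) => o; rewrite ?expr1 ?opprK //; lia.
have sign_expr f : sign_valued (fun j => (-1) ^+ f j : R).
  by move=> j; rewrite -signr_odd; case: (odd _); [right|left].
(* The constant sequence carries no divisibility condition, so it gives existence for every [n]. *)
have orth1 : orthogonal_circulant_generator d (g1 R n).
  rewrite g1E; apply/(@orthogonal_balanced R n n0 (fun=> 1)) => //; last exact: balanced1.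
  by move=> j; left.
split; last by exists (g1 R n).
move=> c; split.
  move=> orth; have [w [ws w0 wp cE]] := orthogonal_generatorP n0 orth.
  move: orth; rewrite cE => /(orthogonal_balanced n0 ws w0 wp) bal.
  have cwE f : w =1 f -> generator n d (fun j => - w j) = generator n d (fun j => - f j).
    by move=> wf; apply: eq_generator => j _; rewrite wf.
  case: (balanced_classification n0 ws w0 wp bal) => [/cwE|[on /cwE]|[n4 /cwE]|[n4 /cwE]] e.
  - by apply: Or41.
  - by apply: Or42; split; rewrite // g2E.
  - by apply: Or43; split; rewrite // g4aE.
  - by apply: Or44; split; rewrite // g4bE.
case=> [->//|[on ->]|[n4 ->]|[n4 ->]].
- rewrite g2E; apply/(orthogonal_balanced n0 (sign_expr id)) => //.
    by move=> j /=; rewrite -signr_odd oddD (negbTE on) addbF signr_odd.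
  exact: balanced_alternating.
- rewrite g4aE; apply/(orthogonal_balanced n0 (sign_expr uphalf)) => //.
    by move=> j; rewrite -signr_odd -[RHS]signr_odd; congr (_ ^+ nat_of_bool _); lia.
  apply: balanced_half_periodic => // j.
  by rewrite addn2 /= exprS mulN1r.
- rewrite g4bE; apply/(orthogonal_balanced n0 (sign_expr half)) => //.
    by move=> j; rewrite -signr_odd -[RHS]signr_odd; congr (_ ^+ nat_of_bool _); lia.
  apply: balanced_half_periodic => // j.
  by rewrite addn2 /= exprS mulN1r.
Qed.
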